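(* Let $\Lambda$ be a finite-dimensional algebra over a field and $\mathcal{F}$ a torsion-free class in $\operatorname{mod}\Lambda$. Suppose that there is a maximal green sequence of $\mathcal{F}$, and let $B_1,\dots,B_l$ be the associated brick sequence. Then the following hold: (1) Every simple object in $\mathcal{F}$ is isomorphic to $B_i$ for some $i$. (2) For $1\le i\le l$, the following are equivalent: (a) $B_i$ is a simple object in $\mathcal{F}$. (b) Every morphism $B_i\to B_j$ with $i<j$ is either zero or injective. (c) There is no surjection $B_i\twoheadrightarrow B_j$ with $i<j$.
   Context: $\operatorname{mod}\Lambda$ is the category of finitely generated right $\Lambda$-modules. A torsion-free class in $\operatorname{mod}\Lambda$ is a full subcategory closed under isomorphisms, submodules and extensions; $\operatorname{torf}\Lambda$ is the poset of torsion-free classes ordered by inclusion. A brick is a module $B$ such that $\operatorname{End}_\Lambda(B)$ is a division ring. For a torsion-free class $\mathcal{G}$, ${}^\perp\mathcal{G}=\{X : \operatorname{Hom}_\Lambda(X,\mathcal{G})=0\}$. Brick labels (known fact of Demonet–Iyama–Reading–Reiten–Thomas): if $\mathcal{F}$ covers $\mathcal{G}$ in $\operatorname{torf}\Lambda$ (written $\mathcal{G}\lessdot\mathcal{F}$), then ${}^\perp\mathcal{G}\cap\mathcal{F}$ contains exactly one brick up to isomorphism; it is called the label of this covering relation. A maximal green sequence of $\mathcal{F}$ is a finite saturated chain $0=\mathcal{F}_0\lessdot\mathcal{F}_1\lessdot\cdots\lessdot\mathcal{F}_l=\mathcal{F}$ in $\operatorname{torf}\Lambda$. Its associated brick sequence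 is $B_1,\dots,B_l$, where $B_i$ is the label of $\mathcal{F}_{i-1}\lessdot\mathcal{F}_i$. A nonzero $M\in\mathcal{F}$ is a simple object in $\mathcal{F}$ if there is no submodule $L$ of $M$ with $0\neq L\neq M$ and $L,M/L\in\mathcal{F}$. *)

(* Defs.v *)
From mathcomp Require Import all_boot all_order all_algebra all_field.

Set Implicit Arguments.
Unset Strict Implicit.
Unset Printing Implicit Defensive.

Import GRing.Theory.
Local Open Scope ring_scope.

Definition finitely_generated (R : nzRingType) (M : lmodType R) : Prop :=
  exists (n : nat) (g : 'I_n -> M),
    forall x : M, exists c : 'I_n -> R, x = \sum_(i < n) c i *: g i.

(* Right A-modules are encoded as left modules over the converse ring A^c. *)
Record fgmod (k : fieldType) (A : falgType k) := Fgmod {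
  fgmod_sort :> lmodType A^c;
  fgmod_fg : finitely_generated fgmod_sort
}.

Section ModuleCategory.
Variables (k : fieldType) (A : falgType k).
Implicit Types (L M N X Y B : fgmod A).

Definition is_zero M : Prop := forall x : M, x = 0.

Definition isomorphic M N : Prop :=
  exists f : {linear M -> N}, bijective f.

Definition surjective M N (f : {linear M -> N}) : Prop :=
  forall y : N, exists x : M, f x = y.

Definition short_exact L M N (i : {linear L -> M}) (p : {linear M -> N}) :
    Prop :=
  [/\ injective i, surjective p
    & forall x : M, p x = 0 <-> exists y : L, i y = x].

(* The first conjunct says that the ring End(B) is nonzero. *)
Definition brick B : Prop :=
  ~ is_zero B /\
  forall f : {linear B -> B}, ~ (forall x, f x = 0) ->
    exists g : {linear B -> B}, cancel f g /\ cancel g f.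

(* [torf_zero] only excludes the empty subcategory. Submodules are given by
   monomorphisms and quotients by short exact sequences. *)
Record torf := Torf {
  torf_mem :> fgmod A -> Prop;
  torf_zero : forall M, is_zero M -> torf_mem M;
  torf_iso : forall M N, isomorphic M N -> torf_mem M -> torf_mem N;
  torf_sub : forall M N (i : {linear M -> N}),
    injective i -> torf_mem N -> torf_mem M;
  torf_ext : forall L M N (i : {linear L -> M}) (p : {linear M -> N}),
    short_exact i p -> torf_mem L -> torf_mem N -> torf_mem M
}.

Definition torf_le (G F : torf) : Prop := forall M, G M -> F M.

Definition torf_lt (G F : torf) : Prop := torf_le G F /\ ~ torf_le F G.

Definition torf_covers (G F : torf) : Prop :=
  torf_lt G F /\ ~ exists H : torf, torf_lt G H /\ torf_lt H F.

Definition left_perp (G : torf) X : Prop :=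
  forall Y, G Y -> forall (f : {linear X -> Y}) (x : X), f x = 0.

(* Such a B exists and is unique up to isomorphism (Demonet, Iyama, Reading,
   Reiten, Thomas); neither fact is built into the definition. *)
Definition is_label (G F : torf) B : Prop :=
  [/\ torf_covers G F, brick B, left_perp G B & F B].

(* Only the values [C 0], ..., [C l] matter. *)
Definition maximal_green_sequence (F : torf) (l : nat) (C : nat -> torf) :
    Prop :=
  [/\ forall M, C 0%N M <-> is_zero M,
      forall i, (i < l)%N -> torf_covers (C i) (C i.+1)
    & forall M, C l M <-> F M].

(* Only the values [B 1], ..., [B l] matter. *)
Definition brick_sequence (l : nat) (C : nat -> torf) (B : nat -> fgmod A) :
    Prop :=
  forall i, (1 <= i <= l)%N -> is_label (C i.-1) (C i) (B i).

Definition simple_object (F : torf) M : Prop :=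
  [/\ F M, ~ is_zero M
    & ~ exists (L N : fgmod A) (i : {linear L -> M}) (p : {linear M -> N}),
        [/\ short_exact i p, ~ is_zero L, ~ surjective i, F L & F N]].

End ModuleCategory.

(* Main.v *)
Require Import Defs.
From mathcomp Require Import all_boot all_order all_algebra all_field.
From HB Require Import structures.
From mathcomp.classical Require Import boolp.

(** If [F] covers [G] and [X], [Y] are nonzero objects of [F] lying in the left
    perpendicular of [G], there is a nonzero map [Y -> X]: otherwise the objects
    of [F] receiving no nonzero map from [Y] would form a torsion-free class
    strictly between [G] and [F]. Applied to the label [B] and the image of a
    nonzero map [X -> B], this gives a nonzero endomorphism of the brick [B]
    through that image, so every such [X] surjects onto [B]. For a nonzero [M]
    in the torsion-free class of a maximal green sequence, take the least [j]
    such that [M] has a nonzero map to an object of [C j]; its image lies in the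
    left perpendicular of [C (j - 1)], so [M] surjects onto the label [B j].
    Both parts of the theorem follow by comparing kernels, since torsion-free
    classes are closed under submodules. *)

Set Implicit Arguments.
Unset Strict Implicit.
Unset Printing Implicit Defensive.

Import GRing.Theory.

(** * Submodules and finite generation *)

Section Submodules.
Local Open Scope ring_scope.

(** The closure proof is an argument of the type, so that the module structure can be inferred from
    the type alone. *)
Definition submodule (R : nzRingType) (M : lmodType R) (S : {pred M})
  of submod_closed S := {x : M | x \in S}.

HB.instance Definition _ (R : nzRingType) (M : lmodType R) (S : {pred M})
  (S_closed : submod_closed S) := SubChoice.on (submodule S_closed).
HB.instance Definition _ (R : nzRingType) (M : lmodType R) (S : {pred M})
  (S_closed : submod_closed S) :=
  GRing.SubChoice_isSubLmodule.Build R M [pred x | x \in S]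
    (submodule S_closed) (GRing.submod_closed_semi S_closed).

(** A subspace of maximal dimension inside [P] exhausts [P], since adjoining another vector of [P]
    would raise the dimension. *)
Lemma vspace_of_closed (k : fieldType) (V : vectType k) (P : V -> Prop) :
    P 0 -> (forall a x y, P x -> P y -> P (a *: x + y)) ->
  exists U : {vspace V}, forall v, v \in U <-> P v.
Proof.
move=> P0 Plin.
pose realized d :=
  `[< exists2 U : {vspace V}, (forall v, v \in U -> P v) & \dim U = d >].
have exd : exists d, realized d.
  by exists 0%N; apply/asboolP; exists 0%VS; rewrite ?dimv0 // => v;
     rewrite memv0 => /eqP->.
have ubd d : realized d -> (d <= \dim {:V})%N.
  by move=> /asboolP[U _ <-]; rewrite dimvS ?subvf.
case: (ex_maxnP exd ubd) => d /asboolP[U UP dimU] maxd.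
exists U => v; split=> [/UP //|Pv].
have UvP w : w \in (U + <[v]>)%VS -> P w.
  case/memv_addP => u uU [_ /vlineP[a ->] ->].
  by rewrite addrC; apply: Plin => //; apply: UP.
have /maxd : realized (\dim (U + <[v]>)%VS).
  by apply/asboolP; exists (U + <[v]>)%VS.
rewrite -dimU => dimUv.
have /eqP -> : U == (U + <[v]>)%VS.
  by rewrite eqEdim addvSl.
by rewrite (subvP (addvSr _ _)) ?memv_line.
Qed.

Lemma finitely_generated_surj (R : nzRingType) (M N : lmodType R)
    (p : {linear M -> N}) :
    (forall y, exists x, p x = y) ->
  finitely_generated M -> finitely_generated N.
Proof.
move=> p_surj [n [g g_gen]]; exists n, (p \o g) => y.
have [x <-] := p_surj y; have [c ->] := g_gen x.
by exists c; rewrite linear_sum; apply: eq_bigr => i _; rewrite linearZ.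
Qed.

(* The preimage of the submodule in a free module [A^n] is a [k]-subspace;
   a [k]-basis of it generates. *)
Lemma finitely_generated_sub (k : fieldType) (A : falgType k)
    (K M : lmodType A^c) (i : {linear K -> M}) :
  injective i -> finitely_generated M -> finitely_generated K.
Proof.
move=> i_inj [n [g g_gen]].
pose phi (c : {ffun 'I_n -> A}) : M := \sum_(m < n) (c m : A^c) *: g m.
have phiP (a : k) (c d : {ffun 'I_n -> A}) :
    phi (a *: c + d) = (a%:A : A^c) *: phi c + phi d.
  rewrite /phi scaler_sumr -big_split; apply: eq_bigr => m _ /=.
  rewrite scalerA -scalerDl !ffunE; congr ((_ + _) *: _).
  exact: esym (mulr_algr a (c m)).
have phi0 : phi 0 = 0.
  by rewrite /phi big1 // => m _; rewrite ffunE; exact: scale0r.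
have [| |U UP] := @vspace_of_closed k {ffun 'I_n -> A}
  (fun c => exists y, i y = phi c).
- by exists 0; rewrite linear0 phi0.
- move=> a c d [y yc] [z zd]; exists ((a%:A : A^c) *: y + z).
  by rewrite linearP yc zd phiP.
have phi_basis (j : 'I_(\dim U)) : exists y, i y == phi (vbasis U)`_j.
  have /vbasis_mem/UP[y /eqP yE] : (vbasis U)`_j \in vbasis U.
    by rewrite mem_nth ?size_tuple.
  by exists y.
pose h j := xchoose (phi_basis j).
exists (\dim U), h => x.
have [c xc] := g_gen (i x).
pose c' := [ffun m => c m : A].
have phi_c' : i x = phi c'.
  by rewrite xc; apply: eq_bigr => m _; rewrite ffunE.
have c'U : c' \in U by apply/UP; exists x.
exists (fun j => (coord (vbasis U) j c')%:A : A^c); apply: i_inj.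
rewrite phi_c' {1}(coord_vbasis c'U) linear_sum.
elim/big_rec2: _ => [|j y d _ <-]; first by rewrite phi0.
rewrite phiP linearZ; congr (_ *: _ + _).
exact/esym/eqP/(xchooseP (phi_basis j)).
Qed.

End Submodules.

(** * Kernels, images and liftings of module maps *)

Section Modules.
Local Open Scope ring_scope.
Variables (k : fieldType) (A : falgType k).
Implicit Types (K L M N X Y B : fgmod A) (F G : torf A).

Lemma submodule_fgmod M (P : M -> Prop) :
    P 0 -> (forall a x y, P x -> P y -> P (a *: x + y)) ->
  exists K (i : {linear K -> M}),
    injective i /\ forall x, P x <-> exists y, i y = x.
Proof.
move=> P0 Plin; pose S : {pred M} := [pred x | `[< P x >]].
have S_closed : submod_closed S.
  split=> [|a x y]; first exact/asboolP.
  by move=> /asboolP Px /asboolP Py; apply/asboolP/Plin.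
pose i : {linear submodule S_closed -> M} := \val.
have i_inj : injective i by exact: val_inj.
exists (Fgmod (finitely_generated_sub i_inj (fgmod_fg M))), i.
split=> // x; split=> [Px|[y <-]].
  have xS : x \in S by exact/asboolP.
  by exists (Sub x xS : submodule S_closed); exact: SubK.
by have /asboolP := valP y.
Qed.

Lemma kernel_fgmod M N (f : {linear M -> N}) :
  exists K (i : {linear K -> M}),
    injective i /\ forall x, f x = 0 <-> exists y, i y = x.
Proof.
apply: submodule_fgmod => [|a x y fx fy]; first exact: linear0.
by rewrite linearP fx fy scaler0 addr0.
Qed.

(** Injectivity of [i] makes the chosen preimages unique, hence linear in [x]. *)
Lemma linear_lift L M Y (i : {linear L -> M}) (g : {linear Y -> M}) :
    injective i -> (forall x, exists y, i y = g x) ->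
  exists h : {linear Y -> L}, forall x, i (h x) = g x.
Proof.
move=> i_inj g_im.
have g_imb x : exists y, i y == g x by have [y /eqP] := g_im x; exists y.
pose h x := xchoose (g_imb x).
have hE x : i (h x) = g x by exact/eqP/(xchooseP (g_imb x)).
have h_lin : linear h.
  by move=> a x y; apply: i_inj; rewrite linearP !hE linearP.
pose hm := GRing.isLinear.Build _ _ _ _ h h_lin.
by exists (HB.pack_for {linear Y -> L} h hm).
Qed.

Lemma image_fgmod M N (f : {linear M -> N}) :
  exists (I : fgmod A) (p : {linear M -> I}) (i : {linear I -> N}),
    [/\ surjective p, injective i & forall x, i (p x) = f x].
Proof.
have [| |I [i [i_inj iP]]] := @submodule_fgmod N (fun y => exists x, f x = y).
- by exists 0; rewrite linear0.
- by move=> a _ _ [x <-] [y <-]; exists (a *: x + y); rewrite linearP.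
have [|p pE] := linear_lift (g := f) i_inj.
  by move=> x; apply/iP; exists x.
exists I, p, i; split=> // y.
have [|x xy] := (iP (i y)).2; first by exists y.
by exists x; apply: i_inj; rewrite pE.
Qed.

Lemma inj_linear M N (f : {linear M -> N}) :
  (forall x, f x = 0 -> x = 0) -> injective f.
Proof.
move=> f0 x y /eqP; rewrite -subr_eq0 -linearB => /eqP/f0/eqP.
by rewrite subr_eq0 => /eqP.
Qed.

Lemma isomorphic_of_inj_surj M N (f : {linear M -> N}) :
  injective f -> surjective f -> isomorphic M N.
Proof.
move=> f_inj f_surj; exists f.
have fb y : exists x, f x == y by have [x /eqP] := f_surj y; exists x.
have fK y : f (xchoose (fb y)) = y by exact/eqP/(xchooseP (fb y)).
by exists (fun y => xchoose (fb y)) => // x; apply: f_inj.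
Qed.

(** * Torsion-free classes and their perpendiculars *)

Lemma torf_im F M N (f : {linear M -> N}) :
    F N -> exists (I : fgmod A) (p : {linear M -> I}) (i : {linear I -> N}),
  [/\ surjective p, injective i, forall x, i (p x) = f x & F I].
Proof.
move=> FN; have [I [p [i [p_surj i_inj ipE]]]] := image_fgmod f.
by exists I, p, i; split=> //; apply: torf_sub i_inj FN.
Qed.

Lemma left_perp_surj G M N (p : {linear M -> N}) :
  surjective p -> left_perp G M -> left_perp G N.
Proof.
move=> p_surj perpM Y GY f y; have [x <-] := p_surj y.
exact: (perpM Y GY (f \o p)).
Qed.

Lemma left_perp_mem_zero G M : left_perp G M -> G M -> is_zero M.
Proof. by move=> perpM GM x; exact: (perpM M GM idfun x). Qed.

(** For extensions: a map from [Y] to the middle term dies in the quotient, so it lifts to the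
    subobject, where it is zero again. *)
Lemma torf_right_perp F Y :
  exists H : torf A,
    forall M, H M <-> F M /\ forall (f : {linear Y -> M}) y, f y = 0.
Proof.
pose H M := F M /\ forall (f : {linear Y -> M}) y, f y = 0.
have H0 M : is_zero M -> H M.
  by move=> M0; split=> [|f y]; [exact: torf_zero | exact: M0].
have Hsub M N (i : {linear M -> N}) : injective i -> H N -> H M.
  move=> i_inj [FN N0]; split=> [|f y]; first exact: torf_sub i_inj FN.
  by apply: i_inj; rewrite linear0; exact: (N0 (i \o f)).
have Hiso M N : isomorphic M N -> H M -> H N.
  move=> MN [FM M0]; split=> [|f y]; first exact: torf_iso MN FM.
  have [g [g' gK g'K]] := MN.
  have [y'|h hE] := linear_lift (g := f) (can_inj gK).
    by exists (g' (f y')).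
  by rewrite -hE M0 linear0.
have Hext L M N (i : {linear L -> M}) (p : {linear M -> N}) :
    short_exact i p -> H L -> H N -> H M.
  move=> ip [FL L0] [FN N0]; split=> [|f y]; first exact: torf_ext ip FL FN.
  have [i_inj _ ipP] := ip.
  have [y'|h hE] := linear_lift (g := f) i_inj.
    by apply/ipP; exact: (N0 (p \o f)).
  by rewrite -hE L0 linear0.
by exists (Torf H0 Hiso Hsub Hext).
Qed.

Lemma torf_covers_hom G F X Y :
    torf_covers G F -> F X -> left_perp G X -> ~ is_zero X ->
    F Y -> left_perp G Y -> ~ is_zero Y ->
  exists f : {linear Y -> X}, ~ forall y, f y = 0.
Proof.
move=> [[GF _] no_mid] FX perpX X0 FY perpY Y0.
apply: contrapT => nof; apply: no_mid.
have [H HP] := torf_right_perp F Y; exists H; split; split.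
- by move=> M GM; apply/HP; split=> [|f y]; [exact: GF | exact: perpY].
(* Without nonzero maps [Y -> X], the object [X] lies in [H]; were [H] inside [G], then [X] would
   lie in [G] and in its left perpendicular. *)
- move=> HG; apply/X0/(left_perp_mem_zero perpX)/HG/HP; split=> // f y.
  by apply: contrapT => fy; apply: nof; exists f => /(_ y).
- by move=> M /HP[].
(* The identity of [Y] keeps [Y] out of [H]. *)
- by move=> /(_ Y FY)/HP[_ /(_ idfun) Y0']; apply: Y0 => y; exact: Y0'.
Qed.

(** * Surjections onto brick labels *)

Lemma brick_endo_inj_surj B (f : {linear B -> B}) :
  brick B -> ~ (forall x, f x = 0) -> injective f /\ surjective f.
Proof.
move=> [_ brickB] /brickB[g [fK gK]].
by split=> [|y]; [exact: can_inj fK | exists (g y)].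
Qed.

Lemma label_quotient G F B X :
    is_label G F B -> F X -> left_perp G X -> ~ is_zero X ->
  exists p : {linear X -> B}, surjective p.
Proof.
move=> [cov brickB perpB FB] FX perpX X0.
have [f f0] := torf_covers_hom cov FB perpB brickB.1 FX perpX X0.
have [I [p [i [p_surj i_inj ipE FI]]]] := torf_im f FB.
have I0 : ~ is_zero I.
  by move=> I0; apply: f0 => x; rewrite -ipE (I0 (p x)) linear0.
have [g g0] := torf_covers_hom cov FI (left_perp_surj p_surj perpX) I0
                 FB perpB brickB.1.
have [|_ ig_surj] := brick_endo_inj_surj (f := i \o g) brickB.
  by move=> ig0; apply: g0 => x; apply: i_inj; rewrite linear0; exact: ig0.
exists f => y; have [b <-] := ig_surj y; have [x xb] := p_surj (g b).
by exists x; rewrite -ipE xb.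
Qed.

(** The kernel and the image of [f] are submodules of objects of [F], so a proper nonzero kernel
    would contradict simplicity. *)
Lemma simple_object_quotient F M N (f : {linear M -> N}) :
  simple_object F M -> F N -> (forall x, f x = 0) \/ injective f.
Proof.
move=> [FM _ simpleM] FN.
have [I [p [i [p_surj i_inj ipE FI]]]] := torf_im f FN.
have [K [j [j_inj jP]]] := kernel_fgmod p.
have [K0|K_neq0] := pselect (is_zero K).
  right; apply: inj_linear => x; rewrite -ipE -(linear0 i) => /i_inj/jP[y <-].
  by rewrite (K0 y) linear0.
have [j_surj|j_nsurj] := pselect (surjective j).
  by left=> x; rewrite -ipE (jP x).2 ?linear0.
case: simpleM; exists K, I, j, p; split=> //.
exact: torf_sub j_inj FM.
Qed.

Lemma mgs_quotient F l (C : nat -> torf A) (B : nat -> fgmod A) M :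
    maximal_green_sequence F l C -> brick_sequence l C B ->
    F M -> ~ is_zero M ->
  exists j (p : {linear M -> B j}), (1 <= j <= l)%N /\ surjective p.
Proof.
move=> [C0 _ CF] CB FM M0.
pose has_map j := `[< exists N (f : {linear M -> N}),
  C j N /\ ~ forall x, f x = 0 >].
have has_map_l : has_map l.
  by apply/asboolP; exists M, idfun; split=> //; exact/CF.
have [j /asboolP[N [f [CN f0]]] minj] := ex_minnP (ex_intro _ l has_map_l).
have [I [p [i [p_surj i_inj ipE CI]]]] := torf_im f CN.
have I0 : ~ is_zero I.
  by move=> I0; apply: f0 => x; rewrite -ipE (I0 (p x)) linear0.
have j_gt0 : (0 < j)%N.
  by case: j CI {minj CN} => // /C0.
have jl : (1 <= j <= l)%N by rewrite j_gt0 minj.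
have [|q q_surj] := label_quotient (CB j jl) CI _ I0.
  (* A nonzero map from the image to an object of [C j.-1], composed with [p], would contradict the
     minimality of [j]. *)
  move=> Y CY g y; have [x <-] := p_surj y; apply: contrapT => gpx.
  have /minj : has_map j.-1.
    by apply/asboolP; exists Y, (g \o p); split=> // /(_ x).
  by rewrite leqNgt ltn_predL j_gt0.
exists j, (q \o p); split=> // b.
by have [y <-] := q_surj b; have [x <-] := p_surj y; exists x.
Qed.

Lemma torf_chain_le l (C : nat -> torf A) :
    (forall i, (i < l)%N -> torf_covers (C i) (C i.+1)) ->
  forall i j, (i <= j <= l)%N -> torf_le (C i) (C j).
Proof.
move=> cov i; elim=> [|j IHj]; first by rewrite leqn0 => /andP[/eqP-> _ M].
case/andP; rewrite leq_eqVlt => /predU1P[-> _ M //|ij jl M CM].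
by apply: (cov j jl).1.1; apply: (IHj _ M CM); rewrite -(ltnS i) ij ltnW.
Qed.

End Modules.

(** * Simple objects among the labels *)

Theorem propositionD (k : fieldType) (A : falgType k) (F : torf A)
    (l : nat) (C : nat -> torf A) (B : nat -> fgmod A)
    (hC : maximal_green_sequence F l C) (hB : brick_sequence l C B) :
  (forall M : fgmod A, simple_object F M ->
     exists i : nat, (1 <= i <= l)%N /\ isomorphic M (B i)) /\
  (forall i : nat, (1 <= i <= l)%N ->
     [<-> simple_object F (B i);
          forall j : nat, (i < j <= l)%N ->
            forall f : {linear B i -> B j},
              (forall x : B i, f x = 0%R) \/ injective f;
          ~ exists (j : nat) (f : {linear B i -> B j}),
              (i < j <= l)%N /\ surjective f]).
Proof.
have [_ cov CF] := hC; have Cle := torf_chain_le cov.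
have B0 i : (1 <= i <= l)%N -> ~ is_zero (B i) by move=> /hB[_ []].
have FB i : (1 <= i <= l)%N -> F (B i).
  move=> il; have [_ _ _ CB] := hB i il; apply/CF; apply: (Cle _ _ _ _ CB).
  by case/andP: il => _ ->; rewrite leqnn.
have surj_n0 (M : fgmod A) i (f : {linear M -> B i}) :
    (1 <= i <= l)%N -> surjective f -> ~ forall x, f x = 0%R.
  by move=> il f_surj f0; apply: (B0 i il) => y; have [x <-] := f_surj y.
split=> [M simpleM|i il].
  have [FM M0 _] := simpleM.
  have [j [p [jl p_surj]]] := mgs_quotient hC hB FM M0.
  exists j; split=> //.
  have [p0|p_inj] := simple_object_quotient p simpleM (FB j jl).
    by case: (surj_n0 _ _ _ jl p_surj p0).
  exact: isomorphic_of_inj_surj p_inj p_surj.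
have [/= _ brickB perpB CB] := hB i il; have /andP[i_gt0 i_le] := il.
tfae.
- move=> simpleB j /andP[ij jl] f.
  apply: (simple_object_quotient f simpleB); apply: FB.
  by rewrite jl (leq_trans _ ij).
- move=> inj_or_0 [j [f [/andP[ij jl] f_surj]]].
  have jl' : (1 <= j <= l)%N by rewrite jl (leq_trans _ ij).
  have [|f0|f_inj] := inj_or_0 j _ f; first by rewrite ij.
    exact: surj_n0 jl' f_surj f0.
  have [_ _ perpBj _] := hB j jl'.
  (* Here [B i] and [B j] are isomorphic, and [i <= j.-1] puts [B i] in [C j.-1]; but [B j] is in
     the left perpendicular of that class. *)
  have CBj : C j.-1 (B j).
    apply: (torf_iso (isomorphic_of_inj_surj f_inj f_surj)).
    apply: (Cle _ _ _ _ CB); rewrite -ltnS prednK ?ij ?(leq_trans _ ij) //=.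
    exact: leq_trans (leq_pred j) jl.
  exact/(B0 j jl')/(left_perp_mem_zero perpBj).
- move=> no_surj; split=> [||[L [N [m [p [mp L0 m_nsurj FL FN]]]]]].
  + exact: FB.
  + exact: B0.
  have [m_inj p_surj mpP] := mp.
  have N0 : ~ is_zero N.
    by move=> N0; apply: m_nsurj => x; apply/mpP; exact: N0.
  (* A proper quotient [N] in [F] maps onto some label [B j], so [B i] does too; each position of
     [j] relative to [i] is impossible. *)
  have [j [q [jl q_surj]]] := mgs_quotient hC hB FN N0.
  have qp_surj : surjective (q \o p).
    by move=> y; have [z <-] := q_surj y; have [x <-] := p_surj z; exists x.
  case: (ltngtP i j) => [ij|ji|eij].
  + by apply: no_surj; exists j, (q \o p); rewrite ij; case/andP: jl.
  (* Now [B j] lies in [C i.-1], which receives no nonzero map from [B i]. *)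
  + have [_ _ _ CBj] := hB j jl.
    apply: (surj_n0 _ _ _ jl qp_surj) => x; apply: perpB.
    apply: (Cle _ _ _ _ CBj).
    by rewrite -ltnS prednK // ji (leq_trans (leq_pred i)).
  (* The type of [q] depends on [j], so it is generalized before rewriting. A surjective
     endomorphism of a brick is injective, which forces the kernel [L] of [p] to vanish. *)
  + move: (q) (jl) qp_surj; rewrite -eij => q' _ qp_surj.
    have [qp_inj _] := brick_endo_inj_surj brickB (surj_n0 _ _ _ il qp_surj).
    apply: L0 => x; apply: m_inj; apply: qp_inj => /=.
    by rewrite (mpP (m x)).2 ?linear0 //; exists x.
Qed.
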